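(* Let $q\in(0,1)$, $n\ge1$, $k\in\{1,\dots,n\}$, and let $E_k(x):=\prod_{j=1}^k(1-q^{-j}x)$. Then for every $a\in\mathbb{R}$ with $aq^{j}\neq1$ for $j=1,\dots,n$, $$p_n(x;a,q^{-k})=E_k(qx)\,p_{n-k}(q^{-k}x;a,q^k).$$ Moreover, if $0<aq<1$, then $p_n(x;a,q^{-k})\in\overline{\mathbb{P}_n^q}((0,1])$.
   Context: For $c\in\mathbb{C}$ and an integer $j\ge0$, $(c;q)_0:=1$ and $(c;q)_j:=\prod_{i=0}^{j-1}(1-cq^i)$. The little $q$-Jacobi polynomial of degree $n$ with parameters $a,b$ is $$p_n(x;a,b)=p_n(x;a,b|q):=\sum_{j=0}^n\frac{(q^{-n};q)_j\,(abq^{n+1};q)_j}{(aq;q)_j\,(q;q)_j}\,(qx)^j ,$$ and $p_{m}(q^{-k}x;a,b)$ denotes this polynomial of degree $m$ evaluated at $q^{-k}x$. For a polynomial $p$ of degree $n\ge2$ with positive zeros $\lambda_1(p)\le\dots\le\lambda_n(p)$ (with multiplicity), its logarithmic mesh is $\operatorname{lmesh}(p):=\max_{1\le j\le n-1}\lambda_j(p)/\lambda_{j+1}(p)$. For $K\subset(0,\infty)$, $\overline{\mathbb{P}_n^q}(K)$ is the set of polynomials of degree $n$ with all zeros in $K$ and with $\operatorname{lmesh}(p)\le q$ (for $n=1$ the condition on the logarithmic mesh is vacuous). *)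

(* Defs.v *)
From mathcomp Require Import all_boot all_order all_algebra.
From mathcomp Require Import classical_sets set_interval reals.

Set Implicit Arguments.
Unset Strict Implicit.
Unset Printing Implicit Defensive.

Import Order.TTheory GRing.Theory Num.Theory.
Local Open Scope ring_scope.

Definition qpoch (F : fieldType) (c q : F) (j : nat) : F :=
  \prod_(i < j) (1 - c * q ^+ i).

(* Meaningful only when (aq;q)_n and (q;q)_n are nonzero; the division of the
   field is total. *)
Definition little_qJacobi (F : fieldType) (q : F) (n : nat) (a b : F) :
    {poly F} :=
  \sum_(j < n.+1)
    (qpoch (q ^- n) q j * qpoch (a * b * q ^+ n.+1) q j
       / (qpoch (a * q) q j * qpoch q q j)) *: (q *: 'X) ^+ j.

Definition qE (F : fieldType) (q : F) (k : nat) : {poly F} :=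
  \prod_(1 <= j < k.+1) (1 - q ^- j *: 'X).

(* [s] lists all the zeros of [p], with multiplicity, in nondecreasing order;
   since [p] splits over the reals it has no other complex zero. *)
Definition ordered_zeros (R : realType) (p : {poly R}) (s : seq R) : Prop :=
  [/\ p != 0, sorted <=%R s & p = lead_coef p *: \prod_(z <- s) ('X - z%:P)].

(* Logarithmic mesh of a polynomial whose ordered zeros are [s], indexed from 0.
   The ratios of positive zeros are positive, so 0 is a neutral default. *)
Definition lmesh (R : realType) (s : seq R) : R :=
  \big[Num.max/0]_(j < (size s).-1) (s`_j / s`_j.+1).

(* The class \overline{P}_n^q(K), for K a subset of the positive reals; [s] is
   determined by [p]. *)
Definition mesh_class (R : realType) (n : nat) (q : R) (K : set R)
    (p : {poly R}) : Prop :=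
  size p = n.+1 /\
  exists s : seq R,
    [/\ ordered_zeros p s, (forall z, z \in s -> K z)
      & (2 <= n)%N -> lmesh s <= q].

(* Main.v *)
Require Import Defs.
From mathcomp Require Import all_boot all_order all_algebra.
From mathcomp Require Import classical_sets set_interval reals.
From mathcomp Require Import ring.
From mathcomp Require boolp.

(** The factorization is Heine's q-Euler transformation of a 2phi1 series.
   Such a series is characterized by the first-order recurrence of its
   coefficients, equivalently by a second-order q-difference equation, where
   the q-shift sends p(x) to p(qx).  Multiplying a solution by
   Q(x) = E_k(qx) turns the equation with parameters q^-(n-k), a q^(n+1) and
   argument q^(1-k) x into the one with parameters q^-n, a q^(n-k+1) and
   argument q x, because Q satisfies
   (1 - q^(1-k) x) Q(qx) = (1 - q x) Q(x).  A solution of degree at most n is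
   determined by its value at 0, so the two sides agree
   ([little_qJacobi_factor]).

   The zeros are located by descending from k = n, where the second factor is
   1 and the polynomial is E_n(qx), with zeros 1, q, ..., q^(n-1).  Replacing k
   by k - 1 multiplies b by q, and this is, up to a nonzero factor, the
   operation p(x) |-> p(x) - c p(qx) with c = a q^(n-k+1)
   ([little_qJacobi_mulq]); here 0 < c < 1 because 0 < aq < 1.

   Such an operation preserves the zeros being in (0,1] with consecutive ratios
   at most q ([q_separated_diff]).  Indeed let l <= q r for consecutive zeros
   l < r of p (or l = 0 and r the first zero).  The new value at l / q is a
   positive multiple of p(l / q) and the one at r is - c p(q r), while both
   points l / q and q r lie in [l, r], where p has constant sign: the new
   polynomial has a zero in [l / q, r].  These disjoint intervals provide all
   the zeros, and the zero before, being at most l, is at most q times the one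
   in [l / q, r]. *)

Set Implicit Arguments.
Unset Strict Implicit.
Unset Printing Implicit Defensive.

Import Order.TTheory GRing.Theory Num.Theory.
Local Open Scope ring_scope.

(** * Coefficients of rescaled and little q-Jacobi polynomials *)

Lemma coef_comp_scaleX (F : comNzRingType) (p : {poly F}) (c : F) (j : nat) :
  (p \Po (c *: 'X))`_j = c ^+ j * p`_j.
Proof.
rewrite coef_comp_poly; under eq_bigr => i _ do rewrite exprZn coefZ coefXn.
have [ltjp|lepj] := ltnP j (size p); last first.
  rewrite nth_default // mulr0 big1 // => i _.
  by rewrite gtn_eqF ?mulr0 // (leq_trans (ltn_ord i)).
rewrite (bigD1 (Ordinal ltjp)) //= eqxx mulr1 big1 ?addr0 1?mulrC // => i ne_ij.
by rewrite [j == _]eq_sym (negbTE (_ : val i != j)) ?mulr0.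
Qed.

Lemma size_comp_scaleX (F : comNzRingType) (p : {poly F}) (c : F) :
  (size (p \Po (c *: 'X)) <= size p)%N.
Proof.
by apply/leq_sizeP => j lepj; rewrite coef_comp_scaleX nth_default ?mulr0.
Qed.

Lemma qpochS (F : fieldType) (c q : F) (j : nat) :
  qpoch c q j.+1 = qpoch c q j * (1 - c * q ^+ j).
Proof. by rewrite /qpoch big_ord_recr. Qed.

(** The two factorials share all factors but one end factor each; the
   cross-multiplied form is also valid when such a factor vanishes. *)
Lemma qpochSl (F : fieldType) (c q : F) (j : nat) :
  (1 - c) * qpoch (c * q) q j = qpoch c q j * (1 - c * q ^+ j).
Proof.
rewrite -qpochS /qpoch big_ord_recl expr0 mulr1; congr (_ * _).
by apply: eq_bigr => i _; rewrite /= exprS mulrA.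
Qed.

(** The formula holds for every [j], as (q^-n; q)_j vanishes beyond degree
   [n]. *)
Lemma coef_little_qJacobi (F : fieldType) (q a b : F) (n j : nat) : q != 0 ->
  (little_qJacobi q n a b)`_j =
    qpoch (q ^- n) q j * qpoch (a * b * q ^+ n.+1) q j
      / (qpoch (a * q) q j * qpoch q q j) * q ^+ j.
Proof.
move=> q0; rewrite /little_qJacobi coef_sum.
under eq_bigr => i _ do rewrite exprZn !coefZ coefXn.
have [ltjn|lenj] := ltnP j n.+1.
  rewrite (bigD1 (Ordinal ltjn)) //= eqxx mulr1 big1 ?addr0 // => i ne_ij.
  by rewrite [j == _]eq_sym (negbTE (_ : val i != j)) ?mulr0.
rewrite big1 => [|i _]; last first.
  by rewrite gtn_eqF ?mulr0 // (leq_trans (ltn_ord i)).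
have -> : qpoch (q ^- n) q j = 0.
  rewrite /qpoch (bigD1 (Ordinal lenj)) //= mulVf ?subrr ?mul0r //.
  by rewrite expf_neq0.
by rewrite !mul0r.
Qed.

Lemma size_little_qJacobi (F : fieldType) (q a b : F) (n : nat) :
  (size (little_qJacobi q n a b) <= n.+1)%N.
Proof.
apply/leq_sizeP => j lenj; rewrite /little_qJacobi coef_sum big1 // => i _.
rewrite exprZn !coefZ coefXn gtn_eqF ?mulr0 //.
exact: leq_trans (ltn_ord i) lenj.
Qed.

Lemma qpoch_neq0 (F : fieldType) (c q : F) (n : nat) :
  (forall i, (i < n)%N -> c * q ^+ i != 1) -> qpoch c q n != 0.
Proof. by move=> h; apply/prodf_neq0 => i _; rewrite subr_eq0 eq_sym h. Qed.

(** * Heine's transformation through the q-difference equation *)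

(** Derives an equation from another one through a ring identity between the
   differences of their sides. *)
Lemma eq_sub_congr (V : zmodType) (u v x y : V) :
  u = v -> x - y = u - v -> x = y.
Proof. by move=> ->; rewrite subrr => /subr0_eq. Qed.

(** The recurrence of the coefficients of the series 2phi1(A, B; aq; q, w x),
   with denominators cleared. *)
Definition hyper_coefs (F : fieldType) (q a A B w : F) (p : {poly F}) : Prop :=
  forall j : nat, (1 - q ^+ j.+1) * (1 - a * q ^+ j.+1) * p`_j.+1 =
    w * (1 - A * q ^+ j) * (1 - B * q ^+ j) * p`_j.

Lemma hyper_coefs_little_qJacobi (F : fieldType) (q a b : F) (n : nat) :
    q != 0 -> (forall j, (1 <= j <= n)%N -> q ^+ j != 1) ->
    (forall j, (1 <= j <= n)%N -> a * q ^+ j != 1) ->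
  hyper_coefs q a (q ^- n) (a * b * q ^+ n.+1) q (little_qJacobi q n a b).
Proof.
move=> q0 hq ha j; have [lejn|ltnj] := leqP n j.
  (* At j = n the factor 1 - A q^j is zero; beyond, both sides are. *)
  rewrite [_`_j.+1]nth_default ?(leq_trans (size_little_qJacobi _ _ _ _)) //.
  have [->|nj] := eqVneq n j; first by rewrite mulVf ?expf_neq0 // subrr; ring.
  rewrite [_`_j]nth_default ?mulr0 ?(leq_trans (size_little_qJacobi _ _ _ _)) //.
  by rewrite ltn_neqAle nj.
rewrite !coef_little_qJacobi // !qpochS.
have d1 : 1 - q * q ^+ j != 0 by rewrite -exprS subr_eq0 eq_sym hq.
have d2 : 1 - a * q * q ^+ j != 0 by rewrite -mulrA -exprS subr_eq0 eq_sym ha.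
have d3 : qpoch (a * q) q j != 0.
  apply: qpoch_neq0 => i ltij; rewrite -mulrA -exprS ha //=.
  exact: leq_trans ltij (ltnW _).
have d4 : qpoch q q j != 0.
  apply: qpoch_neq0 => i ltij; rewrite -exprS hq //=.
  exact: leq_trans ltij (ltnW _).
rewrite !exprS; move: d1 d2 d3 d4; rewrite -[a * q * _]mulrA.
move: (qpoch _ _ _) (qpoch _ _ _) => u v d1 d2 d3 d4; field.
by rewrite d1 d2 d3 d4 expf_neq0.
Qed.

(** The leading factors of the recurrence may vanish beyond index [n], whence
   the bounds on the degrees. *)
Lemma hyper_coefs_eq (F : fieldType) (q a A B w : F) (n : nat) (f g : {poly F}) :
    (forall j, (1 <= j <= n)%N -> q ^+ j != 1) ->
    (forall j, (1 <= j <= n)%N -> a * q ^+ j != 1) ->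
    (size f <= n.+1)%N -> (size g <= n.+1)%N -> f`_0 = g`_0 ->
    hyper_coefs q a A B w f -> hyper_coefs q a A B w g ->
  f = g.
Proof.
move=> hq ha sf sg fg0 hf hg; apply/polyP => j.
have [ltnj|] := ltnP n j; first by rewrite !nth_default ?(leq_trans _ ltnj).
elim: j => // j IHj ltjn; have := hf j; rewrite (IHj (ltnW ltjn)) -(hg j).
by apply: mulfI; rewrite mulf_neq0 // subr_eq0 eq_sym ?hq ?ha.
Qed.

(** The q-shift multiplies the coefficient of degree j by q^j, so that the
   recurrence is the coefficientwise form of the q-difference equation
   (1 - S)(1 - a S) p = w x (1 - A S)(1 - B S) p, with S the q-shift. *)
Lemma hyper_coefsP (F : fieldType) (q a A B w : F) (p : {poly F}) :
  let sp := p \Po (q *: 'X) in let ssp := sp \Po (q *: 'X) in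
  hyper_coefs q a A B w p <->
  p - (1 + a)%:P * sp + a%:P * ssp =
    w%:P * 'X * (p - (A + B)%:P * sp + (A * B)%:P * ssp).
Proof.
move=> sp ssp.
have E (c d : F) j : (p - c%:P * sp + d%:P * ssp)`_j =
    (1 - c * q ^+ j + d * q ^+ j * q ^+ j) * p`_j.
  by rewrite !(coefD, coefN, coefCM) !coef_comp_scaleX; ring.
split=> [hp|eqp j].
  apply/polyP => -[|j]; rewrite E -[w%:P * _ * _]mulrA coefCM coefXM /=; first by ring.
  rewrite E; have := hp j; rewrite exprS => hj; apply: (eq_sub_congr hj); ring.
have := congr1 (fun p : {poly F} => p`_j.+1) eqp.
rewrite /= E -[w%:P * _ * _]mulrA coefCM coefXM /= E exprS => hj.
apply: (eq_sub_congr hj); ring.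
Qed.

Lemma qE_comp_scaleX (F : fieldType) (q : F) (k : nat) :
  qE q k \Po (q *: 'X) = \prod_(1 <= j < k.+1) (1 - (q ^- j * q) *: 'X).
Proof.
rewrite /qE rmorph_prod /=; apply: eq_bigr => j _.
by rewrite comp_polyB comp_polyZ comp_polyX -polyC1 comp_polyC scalerA.
Qed.

(** The product telescopes: a q-shift moves its factors one step along, losing
   the one at one end and gaining one at the other. *)
Lemma qE_functional (F : fieldType) (q : F) (k : nat) : q != 0 ->
  let Q := qE q k \Po (q *: 'X) in
  (1 - (q ^- k * q) *: 'X) * (Q \Po (q *: 'X)) = (1 - q *: 'X) * Q.
Proof.
move=> q0 /=; rewrite !qE_comp_scaleX rmorph_prod /=.
elim: k => [|k IHk]; first by rewrite !big_geq // expr0 invr1 mul1r.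
rewrite !(big_nat_recr k.+1) //= [RHS]mulrA -IHk.
rewrite comp_polyB comp_polyZ comp_polyX -polyC1 comp_polyC scalerA.
have -> : q ^- k.+1 * q * q = q ^- k * q by rewrite exprS; field; rewrite expf_neq0.
ring.
Qed.

Lemma size_qE_comp (F : fieldType) (q : F) (k : nat) :
  (size (qE q k \Po (q *: 'X)) <= k.+1)%N.
Proof.
apply: (leq_trans (size_comp_scaleX _ _)); rewrite /qE.
elim: k => [|k IHk]; first by rewrite big_geq // size_poly1.
rewrite big_nat_recr //= (leq_trans (size_polyMleq _ _)) //.
have s2 : (size (1 - q ^- k.+1 *: 'X : {poly F})%R <= 2)%N.
  rewrite (leq_trans (size_polyD _ _)) // geq_max size_poly1 size_polyN.
  by rewrite (leq_trans (size_scale_leq _ _)) // size_polyX.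
by rewrite -subn1 leq_subLR (leq_trans (leq_add IHk s2)) ?addn2.
Qed.

(** Both sides solve the same recurrence.  For the product, the functional
   equation of E_k(qx) lets its q-shift Q(qx) be factored out of the
   q-difference equation, leaving the equation of the second factor. *)
Lemma little_qJacobi_factor (F : fieldType) (q a : F) (n k : nat) :
    q != 0 -> (forall j, (1 <= j <= n)%N -> q ^+ j != 1) ->
    (forall j, (1 <= j <= n)%N -> a * q ^+ j != 1) -> (k <= n)%N ->
  little_qJacobi q n a (q ^- k) =
    (qE q k \Po (q *: 'X)) *
    (little_qJacobi q (n - k) a (q ^+ k) \Po (q ^- k *: 'X)).
Proof.
move=> q0 hq ha lekn.
set Q := qE q k \Po _; set g := little_qJacobi q (n - k) _ _; set h := g \Po _.
have sQ := size_qE_comp q k; have sg : (size h <= (n - k).+1)%N.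
  exact: leq_trans (size_comp_scaleX _ _) (size_little_qJacobi _ _ _ _).
have lit0 m b : (little_qJacobi q m a b)`_0 = 1.
  by rewrite coef_little_qJacobi // /qpoch !big_ord0 !(mulr1, invr1, expr0).
apply: (hyper_coefs_eq hq ha _ _ _ (hyper_coefs_little_qJacobi _ q0 hq ha)).
- exact: size_little_qJacobi.
- rewrite (leq_trans (size_polyMleq _ _)) // -subn1 leq_subLR.
  by rewrite (leq_trans (leq_add sQ sg)) // addSn addnS subnKC.
- rewrite lit0 coefM big_ord1 subnn [h`_0]coef_comp_scaleX lit0 expr0 !mulr1.
  rewrite -horner_coef0 /Q qE_comp_scaleX horner_prod big1 // => j _.
  by rewrite !hornerE ?mulr0 ?subr0.
have hg : hyper_coefs q a (q ^- (n - k)) (a * q ^+ n.+1) (q ^- k * q) h.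
  have hm j : (1 <= j <= n - k)%N -> (1 <= j <= n)%N.
    by case/andP=> -> /leq_trans -> //; rewrite leq_subr.
  move=> j; rewrite !coef_comp_scaleX.
  have := @hyper_coefs_little_qJacobi _ q a (q ^+ k) (n - k) q0
    (fun j l => hq j (hm j l)) (fun j l => ha j (hm j l)) j.
  rewrite -/g -[a * q ^+ k * _]mulrA -exprD addnS subnKC // => hj.
  apply: (eq_sub_congr (congr1 ( *%R (q ^- k ^+ j.+1)) hj)).
  by rewrite [q ^- k ^+ _]exprS; ring.
have /hyper_coefsP /= {hg} := hg; rewrite -/h => hg.
apply/hyper_coefsP => /=; rewrite !comp_polyM.
have /= := qE_functional k q0; rewrite -/Q.
set Q1 := Q \Po _ => H1; set Q2 := Q1 \Po _.
have H2 : (1 - (q ^- k * q * q) *: 'X) * Q2 = (1 - (q * q) *: 'X) * Q1.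
  have := congr1 (fun p => p \Po (q *: 'X)) H1.
  rewrite /= !comp_polyM !comp_polyB !comp_polyZ !comp_polyX -!polyC1.
  by rewrite !comp_polyC !scalerA.
move: hg H1 H2; set h1 := h \Po _; set h2 := h1 \Po _.
have qk0 : q ^+ k != 0 by rewrite expf_neq0.
have qm0 : q ^+ (n - k) != 0 by rewrite expf_neq0.
(* The two equations match because their parameters satisfy E1, E2 and E3. *)
have E1 : q * (q ^- n + a * q ^- k * q ^+ n.+1) =
    q ^- k * q * (q ^- (n - k) + a * q ^+ n.+1).
  rewrite exprS -(subnKC lekn) [(k + _ - k)%N]addKn exprD; field; by rewrite qk0 qm0.
have E2 : q ^- n * (a * q ^- k * q ^+ n.+1) = a * (q ^- k * q).
  by rewrite exprS; field; rewrite qk0 expf_neq0.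
have E3 : q ^- k * q * (q ^- (n - k) * (a * q ^+ n.+1)) = a * (q * q).
  rewrite exprS -(subnKC lekn) [(k + _ - k)%N]addKn exprD; field; by rewrite qk0 qm0.
rewrite E2; move: E1 E3; set A := _ + _; set A' := _ + _; set B' := q ^- _ * _.
move=> /(congr1 (@polyC F)); rewrite !polyCM => E1.
move=> /(congr1 (@polyC F)); rewrite !polyCM => E3.
rewrite -!mul_polyC !polyCM => hg H1 H2; apply: subr0_eq.
(* The goal is the combination of the equations with these multipliers. *)
have D (u v : {poly F}) : u = v -> u - v = 0 by move=> ->; rewrite subrr.
move: (D _ _ hg) (D _ _ H1) (D _ _ H2) (D _ _ E1) (D _ _ E3).
set dg := _ - _ => dg0; set d1 := _ - _ => d10; set d2 := _ - _ => d20.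
set e1 := _ - _ => e10; set e3 := _ - _ => e30.
transitivity (Q1 * dg - h * d1 + a%:P * h2 * d2 + Q1 * h1 * 'X * e1
              + Q1 * h2 * 'X * e3).
  by rewrite /dg /d1 /d2 /e1 /e3; ring.
by rewrite dg0 d10 d20 e10 e30 !mulr0 !addr0 subr0.
Qed.

(** * Consecutive zeros of ratio at most q *)

(** Multiplying [b] by [q] multiplies the coefficient of degree j by
   (1 - c q^j) / (1 - c), which is what subtracting [c] times the q-shift does,
   up to a constant. *)
Lemma little_qJacobi_mulq (F : fieldType) (q a b : F) (n : nat) : q != 0 ->
  let p := little_qJacobi q n a b in let c := a * b * q ^+ n.+1 in
  p - c *: (p \Po (q *: 'X)) = (1 - c) *: little_qJacobi q n a (b * q).
Proof.
move=> q0 p c; apply/polyP => j.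
rewrite coefB !coefZ coef_comp_scaleX !coef_little_qJacobi //.
have -> : a * (b * q) * q ^+ n.+1 = c * q by rewrite /c; ring.
rewrite -/c; have := qpochSl c q j.
move: (qpoch (c * q) q j) (qpoch c q j) => u v uv.
set w := (_ * qpoch _ _ _)^-1; set x := qpoch (q ^- n) q j.
apply: (eq_sub_congr (congr1 (fun y => - (x * w * q ^+ j * y)) uv)); ring.
Qed.

Definition q_gap (R : realFieldType) (q x y : R) : bool := x <= q * y.

(** The path starts at 0, which makes its terms nonnegative, and 0 is not a
   root, so they are positive.  Then [s] is strictly increasing, and the bound on the
   degree forces it to list all the zeros and these to be simple. *)
Definition q_separated (R : realFieldType) (q : R) (n : nat) (p : {poly R}) : Prop :=
  p.[0] != 0 /\
  exists s : seq R, [/\ size s = n, (size p <= n.+1)%N, path (q_gap q) 0 s,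
    all (fun z => z <= 1) s & all (root p) s].

Lemma path_q_gap_lt (R : realFieldType) (q x : R) (s : seq R) :
  0 < q < 1 -> 0 <= x -> 0 \notin s -> path (q_gap q) x s -> path <%R x s.
Proof.
case/andP=> q0 q1; elim: s x => //= y s IHs x x0.
rewrite inE negb_or eq_sym => /andP[y0 s0] /andP[xy /IHs->//]; last first.
  by rewrite -(pmulr_rge0 _ q0); apply: le_trans xy.
have {}y0 : 0 < y.
  by rewrite lt0r y0 -(pmulr_rge0 _ q0); apply: le_trans xy.
by rewrite andbT (le_lt_trans xy) // gtr_pMl.
Qed.

Lemma q_separated_zeros (R : realFieldType) (q : R) (p : {poly R}) (s : seq R) :
    0 < q < 1 -> p.[0] != 0 -> (size p <= (size s).+1)%N ->
    path (q_gap q) 0 s -> all (root p) s ->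
  [/\ path <%R 0 s, size p = (size s).+1 &
      p = lead_coef p *: \prod_(z <- s) ('X - z%:P)].
Proof.
move=> hq p0 sp gap rs.
have s0 : 0 \notin s by apply: contra p0 => /(allP rs).
have lt_s := path_q_gap_lt hq (lexx 0) s0 gap.
have us : uniq s by apply: lt_sorted_uniq (path_sorted lt_s).
have pn0 : p != 0 by apply: contraNneq p0 => ->; rewrite horner0.
have szp : size p = (size s).+1.
  by apply/eqP; rewrite eqn_leq sp max_poly_roots.
by split=> //; apply: all_roots_prod_XsubC; rewrite ?uniq_rootsE.
Qed.

Lemma poly_ivt_mul (R : rcfType) (p : {poly R}) (x y : R) :
  x <= y -> p.[x] * p.[y] <= 0 -> exists2 z, x <= z <= y & root p z.
Proof.
move=> xy; have [px|px|px] := ltgtP p.[x] 0.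
- rewrite nmulr_rle0 // => py; apply: poly_ivt => //.
  by rewrite (ltW px).
- rewrite pmulr_rle0 // => py.
  have [||z] := @poly_ivt _ (- p) x y; rewrite ?hornerN ?oppr_le0 ?oppr_ge0 //.
    by rewrite (ltW px).
  by rewrite rootN; exists z.
- by move=> _; exists x; rewrite ?lexx // /root px.
Qed.

(** A split polynomial without zeros strictly between [l] and [r] keeps a
   constant sign on [[l, r]], since each linear factor does. *)
Lemma horner_mul_ge0_between (R : realFieldType) (p : {poly R}) (c l r u v : R)
    (s : seq R) :
    p = c *: \prod_(z <- s) ('X - z%:P) ->
    (forall z, z \in s -> (z <= l) || (r <= z)) ->
    l <= u <= r -> l <= v <= r ->
  0 <= p.[u] * p.[v].
Proof.
move=> -> hs /andP[lu ur] /andP[lv vr].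
rewrite !hornerZ !horner_prod mulrACA -expr2 mulr_ge0 ?sqr_ge0 //.
rewrite -big_split /=; rewrite big_seq; apply: prodr_ge0 => z /hs /orP[zl|rz].
  by rewrite !hornerXsubC mulr_ge0 ?subr_ge0 // (le_trans zl).
by rewrite !hornerXsubC mulr_le0 ?subr_le0 // (le_trans _ rz).
Qed.

(** The new zeros are found one in each interval [[l / q, r]], where [l] is the
   zero before [r], or 0: the values at its ends are positive multiples of p(l / q)
   and - p(q r), and both arguments lie between [l] and [r], where [p] does not
   change sign. *)
Lemma q_separated_diff (R : rcfType) (q c : R) (n : nat) (p : {poly R}) :
    0 < q < 1 -> 0 < c < 1 -> q_separated q n p ->
  q_separated q n (p - c *: (p \Po (q *: 'X))).
Proof.
move=> hq /andP[c0 c1] [p0 [s [szs szp gap s1 rs]]].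
set Tp := p - _; have [q0 q1] := andP hq.
have ETp x : Tp.[x] = p.[x] - c * p.[q * x].
  by rewrite /Tp !(hornerE, horner_comp).
have [|lt_s _ Ep] := q_separated_zeros hq p0 _ gap rs; first by rewrite szs.
have Tp0 : Tp.[0] != 0.
  by rewrite ETp mulr0 -{1}[p.[0]]mul1r -mulrBl mulf_neq0 // subr_eq0 gt_eqF.
have le_s : sorted <=%R (0 :: s) by apply: sub_path lt_s => x y /ltW.
have gap_nth i : (i < n)%N -> (0 :: s)`_i <= q * s`_i.
  by move=> ltin; move/(pathP 0): gap; apply; rewrite szs.
have ge0_nth i : (i <= n)%N -> 0 <= (0 :: s)`_i.
  move=> lein; rewrite -[0]/((0 :: s)`_0).
  by apply: (sorted_leq_nth le_trans lexx 0 le_s); rewrite ?inE //= szs.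
have root_i i : exists x, (i < n)%N ->
    ((0 :: s)`_i / q <= x <= s`_i) && root Tp x.
  have [ltin|_] := ltnP i n; last by exists 0.
  set l := _`_i; set r := s`_i.
  have lr : l <= q * r := gap_nth i ltin.
  have l0 : 0 <= l := ge0_nth i (ltnW ltin).
  have r0 : 0 <= r := ge0_nth i.+1 ltin.
  have ler : q * r <= r by rewrite ler_piMl // ltW.
  have llq : l <= l / q by rewrite ler_pdivlMr // ler_piMr // ltW.
  have lqr : l / q <= r by rewrite ler_pdivrMr // mulrC.
  have out z : z \in s -> (z <= l) || (r <= z).
    move=> /(nthP 0)[j]; rewrite szs => ltjn <-; have [ltji|leij] := ltnP j i.
      apply/orP; left; rewrite -[s`_j]/((0 :: s)`_j.+1).
      by apply: (sorted_leq_nth le_trans lexx 0 le_s); rewrite ?inE /= ?szs ?ltnS // ltnW.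
    apply/orP; right.
    by apply: (sorted_leq_nth le_trans lexx 0 (path_sorted le_s)); rewrite ?inE ?szs.
  have sgn u v : l <= u <= r -> l <= v <= r -> 0 <= p.[u] * p.[v].
    exact: (horner_mul_ge0_between Ep out).
  (* Either l is a zero of p, or l = 0 and both terms are multiples of p(0). *)
  have Tpl : exists2 d, 0 <= d & Tp.[l / q] = d * p.[l / q].
    rewrite ETp [q * _]mulrC divfK ?gt_eqF //; move: ltin; rewrite /l.
    case: (i) => [|j] ltjn /=.
      by exists (1 - c); [rewrite subr_ge0 ltW | rewrite mul0r; ring].
    have /eqP -> : root p s`_j by apply: (allP rs); rewrite mem_nth ?szs // ltnW.
    by exists 1 => //; rewrite mulr0 subr0 mul1r.
  have Tpr : Tp.[r] = - (c * p.[q * r]).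
    have /eqP pr : root p r by apply: (allP rs); rewrite mem_nth ?szs.
    by rewrite ETp pr sub0r.
  have [d d0 Ed] := Tpl.
  have [|x hx rx] := @poly_ivt_mul _ Tp (l / q) r lqr.
    rewrite Ed Tpr mulrN oppr_le0 mulrACA mulr_ge0 //; first by rewrite mulr_ge0 // ltW.
    by apply: sgn; rewrite ?llq ?lqr ?lr ?ler.
  by exists x => _; rewrite hx.
have [f hf] := boolp.choice root_i.
split=> //; exists (mkseq f n); split.
- by rewrite size_mkseq.
- rewrite (leq_trans (size_polyD _ _)) // geq_max szp size_polyN.
  rewrite (leq_trans (size_scale_leq _ _)) //.
  exact: leq_trans (size_comp_scaleX _ _) szp.
- apply/(pathP 0) => i; rewrite size_mkseq => ltin; rewrite nth_mkseq // /q_gap.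
  have /andP[/andP[lf _] _] := hf i ltin.
  rewrite mulrC -ler_pdivrMr //; apply: le_trans lf.
  rewrite ler_pM2r ?invr_gt0 //; case: i ltin => //= i ltin.
  have /andP[/andP[_ fr] _] := hf i (ltnW ltin).
  by rewrite nth_mkseq // ltnW.
- apply/(all_nthP 0) => i; rewrite size_mkseq => ltin; rewrite nth_mkseq //.
  have /andP[/andP[_ fr] _] := hf i ltin.
  by apply: le_trans fr _; apply: (allP s1); rewrite mem_nth ?szs.
- apply/(all_nthP 0) => i; rewrite size_mkseq => ltin; rewrite nth_mkseq //.
  by have /andP[] := hf i ltin.
Qed.

Lemma q_separated_scale (R : realFieldType) (q d : R) (n : nat) (p : {poly R}) :
  d != 0 -> q_separated q n (d *: p) -> q_separated q n p.
Proof.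
move=> d0 [p0 [s [szs szp gap s1 rs]]]; split.
  by apply: contraNneq p0 => p0; rewrite hornerZ p0 mulr0.
exists s; split=> //; first by rewrite -(size_scale p d0).
by apply/allP => z /(allP rs); rewrite rootZ.
Qed.

Lemma q_separated_qE (R : realFieldType) (q : R) (n : nat) :
  0 < q < 1 -> q_separated q n (qE q n \Po (q *: 'X)).
Proof.
move=> /andP[q0 q1]; split.
  rewrite qE_comp_scaleX horner_prod big1 ?oner_neq0 // => j _.
  by rewrite !hornerE ?mulr0 ?subr0.
exists (mkseq (fun i => q ^+ (n - i.+1)) n); split.
- by rewrite size_mkseq.
- exact: size_qE_comp.
- apply/(pathP 0) => i; rewrite size_mkseq => ltin; rewrite nth_mkseq // /q_gap.
  rewrite -exprS; case: i ltin => [|i] ltin /=; first by rewrite exprn_ge0 // ltW.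
  by rewrite nth_mkseq ?subnSK // ltnW.
- apply/(all_nthP 0) => i; rewrite size_mkseq => ltin; rewrite nth_mkseq //.
  by rewrite exprn_ile1 // ltW.
- apply/(all_nthP 0) => i; rewrite size_mkseq => ltin; rewrite nth_mkseq //.
  rewrite qE_comp_scaleX /root horner_prod (bigD1_seq (n - i)%N) ?iota_uniq //=.
    rewrite !hornerE -subnSK // exprS [X in 1 - X](_ : _ = 1) ?subrr ?mul0r //.
    by field; rewrite expf_neq0 gt_eqF.
  by rewrite mem_index_iota subn_gt0 ltin ltnS leq_subr.
Qed.

Lemma expr_neq1 (R : realFieldType) (q : R) (j : nat) :
  0 < q < 1 -> (0 < j)%N -> q ^+ j != 1.
Proof. by case/andP=> q0 q1 j0; rewrite lt_eqF // exprn_ilt1 ?ltW // -lt0n. Qed.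

(** Induction on [n - k], from the explicit product at [k = n]; the bound
   0 < aq < 1 puts every constant c = a q^(n - k + 1) in (0, 1). *)
Lemma q_separated_little_qJacobi (R : realType) (q a : R) (n k : nat) :
    0 < q < 1 -> 0 < a * q < 1 ->
    (forall j : nat, (1 <= j <= n)%N -> a * q ^+ j != 1) -> (k <= n)%N ->
  q_separated q n (little_qJacobi q n a (q ^- k)).
Proof.
move=> hq /andP[aq0 aq1] ha lekn; have /andP[q0 q1] := hq.
have qn0 : q != 0 by rewrite gt_eqF.
rewrite -(subKn lekn); elim: (n - k)%N (leq_subr k n) => [|i IHi] ltin.
  rewrite subn0 little_qJacobi_factor // ?subnn; last first.
    by move=> j /andP[j0 _]; rewrite expr_neq1.
  have -> : little_qJacobi q 0 a (q ^+ n) = 1.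
    by rewrite /little_qJacobi big_ord1 /qpoch !big_ord0 !(expr0, mulr1, invr1, scale1r).
  by rewrite -polyC1 comp_polyC mulr1; apply: q_separated_qE.
have := little_qJacobi_mulq a (q ^- (n - i)) n qn0.
set c := _ * _ * _ => /=.
have Ec : c = a * q * q ^+ i.
  rewrite /c -{2}(subnK (ltnW ltin)) -addnS exprD [q ^+ i.+1]exprS.
  by field; rewrite expf_neq0.
have -> : q ^- (n - i) * q = q ^- (n - i.+1).
  by rewrite -(subnSK ltin) exprS invfM mulrAC mulVf // mul1r.
have hc : 0 < c < 1.
  rewrite Ec mulr_gt0 ?exprn_gt0 //= (le_lt_trans _ aq1) //.
  by rewrite ger_pMr // exprn_ile1 ?ltW.
move=> E; apply: (@q_separated_scale _ _ (1 - c)).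
  by rewrite subr_eq0 gt_eqF //; case/andP: hc.
by rewrite -E; apply: q_separated_diff => //; apply: IHi; apply: ltnW.
Qed.

Lemma mesh_class_q_separated (R : realType) (q : R) (n : nat) (p : {poly R}) :
  0 < q < 1 -> q_separated q n p -> mesh_class n q `]0, 1]%classic p.
Proof.
move=> hq [p0 [s [szs szp gap s1 rs]]]; have /andP[q0 q1] := hq.
have [|lt_s sz Ep] := q_separated_zeros hq p0 _ gap rs; first by rewrite szs.
split; first by rewrite sz szs.
have pos z : z \in s -> 0 < z by apply: (allP (order_path_min lt_trans lt_s)).
exists s; split.
- split=> //; first by rewrite -size_poly_gt0 sz.
  by apply: sub_sorted (path_sorted lt_s) => x y /ltW.
- by move=> z zs; rewrite /= in_itv /= pos //= (allP s1).
- move=> _; apply: bigmax_le; first exact: ltW.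
  move=> [j ltj] _ /=; have ltj1 : (j.+1 < size s)%N by rewrite -ltn_predRL.
  rewrite ler_pdivrMr; last by rewrite pos // mem_nth.
  by have /(pathP 0) /(_ j.+1 ltj1) := gap.
Qed.

Theorem proposition3p4 (R : realType) (q : R) (n k : nat)
    (hq : 0 < q < 1) (hn : (1 <= n)%N) (hk : (1 <= k <= n)%N)
    (a : R) (ha : forall j : nat, (1 <= j <= n)%N -> a * q ^+ j != 1) :
  little_qJacobi q n a (q ^- k) =
    (qE q k \Po (q *: 'X)) *
    (little_qJacobi q (n - k) a (q ^+ k) \Po (q ^- k *: 'X))
  /\ (0 < a * q < 1 ->
      mesh_class n q `]0, 1]%classic (little_qJacobi q n a (q ^- k))).
Proof.
have [_ lekn] := andP hk; have [q0 q1] := andP hq; split.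
  apply: little_qJacobi_factor => //; first by rewrite gt_eqF.
  by move=> j /andP[j0 _]; rewrite expr_neq1.
by move=> haq; apply/mesh_class_q_separated/q_separated_little_qJacobi.
Qed.
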